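(* Consider an active STAR element with independent transmission and reflection (T&R) phase-shift, i.e. a four-port quadrature hybrid with complex input voltages $V_1^+,\dots,V_4^+$ and output voltages $V_1^-,\dots,V_4^-$ satisfying $$\begin{pmatrix} V_1^- \\ V_2^- \\ V_3^- \\ V_4^- \end{pmatrix}=-\frac{1}{\sqrt2}\begin{pmatrix}0&j&1&0\\ j&0&0&1\\ 1&0&0&j\\ 0&1&j&0\end{pmatrix}\begin{pmatrix} V_1^+ \\ V_2^+ \\ V_3^+ \\ V_4^+ \end{pmatrix},$$ whose ports 2 and 3 are each connected to a delay line and reflection-type amplifier with combined complex gains $\tilde G_2\in\mathbb{C}$ and $\tilde G_3\in\mathbb{C}$ respectively, so that $V_2^+=\tilde G_2V_2^-$ and $V_3^+=\tilde G_3V_3^-$. Then the four T&R coefficients of the element are $$R^A_m=-R^B_m=\frac{\tilde G_3-\tilde G_2}{2},\qquad T^{AB}_m=T^{BA}_m=\frac{j(\tilde G_2+\tilde G_3)}{2}.$$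
   Context: Here $j$ is the imaginary unit, and $m$ indexes the element. Port 1 of the hybrid is side A of the element and port 4 is side B: $V_1^+,V_4^+$ are the signals incident from sides A and B (arbitrary complex numbers), and $V_1^-,V_4^-$ are the signals leaving through sides A and B. The combined gains are $\tilde G_2=G_2e^{j\phi_2}$ and $\tilde G_3=G_3e^{j\phi_3}$, where $G_2,G_3$ are the amplifier gains and $\phi_2,\phi_3$ the phase delays. The T&R coefficients are defined by $$R^A_m=\frac{V_1^-}{V_1^+}\Big|_{V_4^+=0},\quad R^B_m=\frac{V_4^-}{V_4^+}\Big|_{V_1^+=0},\quad T^{AB}_m=\frac{V_1^-}{V_4^+}\Big|_{V_1^+=0},\quad T^{BA}_m=\frac{V_4^-}{V_1^+}\Big|_{V_4^+=0},$$ where $\frac{V_i^-}{V_k^+}\big|_{V_l^+=0}$ means the ratio of these voltages when $V_l^+=0$ and $V_k^+\neq 0$. *)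

(* Defs.v *)
From mathcomp Require Import all_boot all_order all_algebra.
From mathcomp Require Import complex reals.

Set Implicit Arguments.
Unset Strict Implicit.
Unset Printing Implicit Defensive.

Import GRing.Theory Num.Theory.
Local Open Scope ring_scope.
Local Open Scope complex_scope.

(* Voltages are column vectors indexed by 'I_4, so port k has index k - 1.    *)
Definition port1 : 'I_4 := Ordinal (isT : 0 < 4)%N.
Definition port2 : 'I_4 := Ordinal (isT : 1 < 4)%N.
Definition port3 : 'I_4 := Ordinal (isT : 2 < 4)%N.
Definition port4 : 'I_4 := Ordinal (isT : 3 < 4)%N.

Section StarElement.
Variable R : realType.

Definition j_unit : R[i] := 0 +i* 1.

Definition quadrature_hybrid : 'M[R[i]]_4 :=
  - (Num.sqrt (2 : R))%:C^-1 *: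
    \matrix_(i < 4, j < 4)
      nth 0 (nth [::] [:: [:: 0     ; j_unit; 1     ; 0     ];
                          [:: j_unit; 0     ; 0     ; 1     ];
                          [:: 1     ; 0     ; 0     ; j_unit];
                          [:: 0     ; 1     ; j_unit; 0     ]] i) j.

(* Vp and Vm collect the voltages V_k^+ entering and V_k^- leaving the hybrid *)
(* at its four ports; Gt2 and Gt3 are the combined complex gains.             *)
Record star_state (Gt2 Gt3 : R[i]) (Vp Vm : 'cV[R[i]]_4) : Prop := StarState {
  hybrid_eq : Vm = quadrature_hybrid *m Vp;
  port2_eq : Vp port2 0 = Gt2 * Vm port2 0;
  port3_eq : Vp port3 0 = Gt3 * Vm port3 0 }.

(* The value V_i^- / V_k^+ at V_l^+ = 0 is c. The incident voltage at port k  *)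
(* may be any nonzero a; asking for a state realizing each such a keeps the   *)
(* universally quantified part from holding vacuously.                        *)
Definition voltage_ratio (Gt2 Gt3 : R[i]) (i k l : 'I_4) (c : R[i]) : Prop :=
  (forall a : R[i], a != 0 ->
     exists Vp Vm, [/\ star_state Gt2 Gt3 Vp Vm, Vp k 0 = a & Vp l 0 = 0]) /\
  (forall Vp Vm, star_state Gt2 Gt3 Vp Vm -> Vp k 0 != 0 -> Vp l 0 = 0 ->
     Vm i 0 / Vp k 0 = c).

Lemma voltage_ratio_unique Gt2 Gt3 i k l c c' :
  voltage_ratio Gt2 Gt3 i k l c -> voltage_ratio Gt2 Gt3 i k l c' -> c = c'.
Proof.
move=> [ex_state cP] [_ c'P].
have [Vp [Vm [st Vk Vl]]] := ex_state 1 (oner_neq0 _).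
have Vk0 : Vp k 0 != 0 by rewrite Vk oner_neq0.
by rewrite -(cP _ _ st Vk0 Vl) -(c'P _ _ st Vk0 Vl).
Qed.

(* Side A is port 1 and side B is port 4; T^{AB} is the transmission from B   *)
(* to A, and T^{BA} the one from A to B.                                      *)
Definition is_reflection_A Gt2 Gt3 := voltage_ratio Gt2 Gt3 port1 port1 port4.
Definition is_reflection_B Gt2 Gt3 := voltage_ratio Gt2 Gt3 port4 port4 port1.
Definition is_transmission_AB Gt2 Gt3 :=
  voltage_ratio Gt2 Gt3 port1 port4 port1.
Definition is_transmission_BA Gt2 Gt3 :=
  voltage_ratio Gt2 Gt3 port4 port1 port4.

End StarElement.

Arguments j_unit {R}.

(* Main.v *)
Require Import Defs.
From mathcomp Require Import all_boot all_order all_algebra.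
From mathcomp Require Import complex reals ring.

(** Eliminating ports 2 and 3 leaves the scattering matrix between ports 1 and
    4. An incident wave is split by the hybrid, amplified by [Gt2] on port 2 and
    by [Gt3] on port 3, and recombined by the hybrid. The two passes contribute
    the factor [(1 / sqrt 2)^2 = 1 / 2], and the products of the hybrid's entries
    along the two paths ([j^2 = -1], [1] or [j]) give the signs. *)

Import GRing.Theory Num.Theory.

Local Open Scope ring_scope.
Local Open Scope complex_scope.

Lemma sum_ports (V : nmodType) (F : 'I_4 -> V) :
  \sum_(i < 4) F i = F port1 + F port2 + F port3 + F port4.
Proof.
rewrite !big_ord_recl big_ord0 addr0 !addrA.
by congr (F _ + F _ + F _ + F _); apply: val_inj.
Qed.

Lemma j_unit_sqr (R : realType) : j_unit * j_unit = -1 :> R[i].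
Proof. by rewrite -expr2 -[j_unit]/('i : R[i]) sqr_i. Qed.

Lemma inv_sqrt2_sqr (R : realType) :
  (Num.sqrt (2 : R))%:C^-1 * (Num.sqrt (2 : R))%:C^-1 = 2^-1 :> R[i].
Proof. by rewrite -invfM -rmorphM /= -expr2 sqr_sqrtr ?ler0n // rmorph_nat. Qed.

Section Scattering.
Variable R : realType.

Let s : R[i] := (Num.sqrt 2)%:C^-1.

Lemma quadrature_hybridE (Vp : 'cV[R[i]]_4) (V := quadrature_hybrid R *m Vp) :
  [/\ V port1 0 = - s * (j_unit * Vp port2 0 + Vp port3 0),
      V port2 0 = - s * (j_unit * Vp port1 0 + Vp port4 0),
      V port3 0 = - s * (Vp port1 0 + j_unit * Vp port4 0)
    & V port4 0 = - s * (Vp port2 0 + j_unit * Vp port3 0)].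
Proof.
by split;
  rewrite /V /quadrature_hybrid -scalemxAl !mxE sum_ports !mxE /=
  !(mul0r, mul1r, add0r, addr0).
Qed.

(** The waves leaving through ports 2 and 3 depend only on those incident at ports 1 and 4, so no
    feedback loop arises: substitution suffices, without inverting a system, and any gains are
    allowed. *)
Lemma star_state_scattering (Gt2 Gt3 : R[i]) (Vp Vm : 'cV[R[i]]_4) :
  star_state Gt2 Gt3 Vp Vm ->
  Vm port1 0 = (Gt3 - Gt2) / 2 * Vp port1 0
               + j_unit * (Gt2 + Gt3) / 2 * Vp port4 0
  /\ Vm port4 0 = j_unit * (Gt2 + Gt3) / 2 * Vp port1 0
               + (Gt2 - Gt3) / 2 * Vp port4 0.
Proof.
case=> hyb e2 e3; have [V1 V2 V3 V4] := quadrature_hybridE Vp.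
rewrite -hyb in V1 V2 V3 V4.
have jj := j_unit_sqr R; have ss : s * s = 2^-1 := inv_sqrt2_sqr R.
(* Writing [2^-1] as [s * s] leaves polynomial identities modulo [j_unit * j_unit = -1]. *)
by rewrite V1 V4 e2 e3 V2 V3 -ss; split; ring: jj.
Qed.

Lemma star_state_exists (Gt2 Gt3 a b : R[i]) :
  exists Vp Vm, [/\ star_state Gt2 Gt3 Vp Vm, Vp port1 0 = a & Vp port4 0 = b].
Proof.
(* The middle entries are the gains times rows 2 and 3 of the hybrid, evaluated at [a] and [b]. *)
pose Vp : 'cV[R[i]]_4 := \col_i nth 0
  [:: a; Gt2 * (- s * (j_unit * a + b)); Gt3 * (- s * (a + j_unit * b)); b] i.
exists Vp, (quadrature_hybrid R *m Vp).
have [_ V2 V3 _] := quadrature_hybridE Vp.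
by split; [split; rewrite // ?V2 ?V3 | |]; rewrite !mxE.
Qed.

End Scattering.

Theorem theorem2 (R : realType) (Gt2 Gt3 : R[i]) :
  exists RA RB TAB TBA : R[i],
    [/\ is_reflection_A Gt2 Gt3 RA,
        is_reflection_B Gt2 Gt3 RB,
        is_transmission_AB Gt2 Gt3 TAB
      & is_transmission_BA Gt2 Gt3 TBA] /\
    [/\ RA = - RB,
        RA = (Gt3 - Gt2) / 2,
        TAB = TBA
      & TAB = j_unit * (Gt2 + Gt3) / 2].
Proof.
exists ((Gt3 - Gt2) / 2), ((Gt2 - Gt3) / 2).
exists (j_unit * (Gt2 + Gt3) / 2), (j_unit * (Gt2 + Gt3) / 2).
split; last by split=> //; rewrite -mulNr opprB.
have from1 a : exists Vp Vm,
    [/\ star_state Gt2 Gt3 Vp Vm, Vp port1 0 = a & Vp port4 0 = 0].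
  exact: star_state_exists.
have from4 a : exists Vp Vm,
    [/\ star_state Gt2 Gt3 Vp Vm, Vp port4 0 = a & Vp port1 0 = 0].
  by have [Vp [Vm []]] := star_state_exists R Gt2 Gt3 0 a; exists Vp, Vm.
(* [from1] and [from4] settle the existence halves. In each ratio, [Vl0] kills one of the two
   scattering terms and [Vk0] allows the division. *)
split; split=> [a _|Vp Vm /star_state_scattering[V1 V4] Vk0 Vl0] //.
- by rewrite V1 Vl0 mulr0 addr0 mulfK.
- by rewrite V4 Vl0 mulr0 add0r mulfK.
- by rewrite V1 Vl0 mulr0 add0r mulfK.
- by rewrite V4 Vl0 mulr0 addr0 mulfK.
Qed.
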